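(* Let $\langle \mathbf{D},\mathcal{R},\mathcal{Q}\rangle$ be a model as described in the context, let $W\in\mathbb{R}^M$ be a fixed terminal reward, and define $W^0:=W$ and $W^{k+1}:=U\circ W^k=\max_{d\in\mathbf{D}}\{\mathcal{R}(d)+\mathcal{Q}(d)W^k\}$ for $k=0,1,2,\ldots$. Suppose that $\lim_{k\to\infty} sp(W^{k+1}-W^k)=0$. Then there exists $K$ such that, in the finite horizon total reward problem with terminal reward $W$ and any time horizon $T>K$, on the first steps $t=1,2,\ldots,T-K$ the optimal decisions are necessarily average optimal; that is, for every $T>K$, every $t\in\{1,\ldots,T-K\}$ and every $\hat d\in\mathbf{D}$ with $\mathcal{R}(\hat d)+\mathcal{Q}(\hat d)W^{T-t}=\max_{d\in\mathbf{D}}\{\mathcal{R}(d)+\mathcal{Q}(d)W^{T-t}\}$, the decision $\hat d$ is average optimal.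
   Context: Model. $M\ge 1$, $\mathbf{S}=\{0,1,\ldots,M-1\}$, functions $W:\mathbf{S}\to\mathbb{R}$ are identified with column vectors in $\mathbb{R}^M$. $\mathbf{D}$ is a nonempty finite set of decisions; each $d\in\mathbf{D}$ has a reward vector $\mathcal{R}(d)\in\mathbb{R}^M$ and a stochastic $M\times M$ matrix $\mathcal{Q}(d)$. Inequalities and maxima of vectors are component-wise. Standing assumption: for every $\beta\in[0,1]$ and every $W\in\mathbb{R}^M$ there exists $\hat d\in\mathbf{D}$ providing the component-wise maximum of $\mathcal{R}(d)+\beta\mathcal{Q}(d)W$ over $d\in\mathbf{D}$, i.e. $\mathcal{R}(\hat d)+\beta\mathcal{Q}(\hat d)W\ge\mathcal{R}(d)+\beta\mathcal{Q}(d)W$ for all $d\in\mathbf{D}$. The operator $U$ on $\mathbb{R}^M$ is $U\circ W:=\max_{d\in\mathbf{D}}\{\mathcal{R}(d)+\mathcal{Q}(d)W\}$. The span-seminorm is $sp(W):=\max_{s\in\mathbf{S}}W(s)-\min_{s\in\mathbf{S}}W(s)$. Finite horizon problem: with horizon $T$ and terminal reward $W$, decisions $d(1),\ldots,d(T)$ are chosen on steps $t=1,\ldots,T$; the state $S(\cdot)$ is the non-homogeneous Markov chain with transition matrix $\mathcal{Q}(d(t))$ at step $t$, the reward at step $t$ is $\mathcal{R}_{S(t-1)}(d(t))$, and the total expected reward including $W(S(T))$ is maximised. The optimal decisions $d(t)$ on step $t$ are those which provide the component-wise maximum of $\mathcal{R}(d)+\mathcal{Q}(d)W^{T-t}$.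 For $d\in\mathbf{D}$, $\mathcal{Q}^*(d):=\lim_{n\to\infty}\frac1n\sum_{k=0}^{n-1}\mathcal{Q}^k(d)$ (the limit exists and is a stochastic matrix). A decision $d^*\in\mathbf{D}$ is average optimal if $\mathcal{Q}^*(d)\mathcal{R}(d)\le\mathcal{Q}^*(d^* )\mathcal{R}(d^* )$ for all $d\in\mathbf{D}$. *)

(* Defs.v *)
From HB Require Import structures.
From mathcomp Require Import all_boot all_order all_algebra.
From mathcomp Require Import all_classical all_reals all_analysis.
Import Order.TTheory GRing.Theory Num.Theory.
Import numFieldNormedType.Exports.

Set Implicit Arguments.
Unset Strict Implicit.
Unset Printing Implicit Defensive.

Local Open Scope classical_set_scope.
Local Open Scope ring_scope.

(* The state space {0, ..., M-1} with M >= 1 is 'I_m.+1, that is M = m.+1,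
   and a function W on the states is a column vector in 'cV[R]_m.+1. *)

(* Maximum and minimum of a family over a nonempty finite type. The point i0
   only witnesses nonemptiness and the values do not depend on it. *)
Definition fmax (R : realType) (I : finType) (i0 : I) (F : I -> R) : R :=
  \big[Num.max/F i0]_(i : I) F i.

Definition fmin (R : realType) (I : finType) (i0 : I) (F : I -> R) : R :=
  \big[Num.min/F i0]_(i : I) F i.

Definition lev (R : realType) (m : nat) (V W : 'cV[R]_m.+1) : Prop :=
  forall s : 'I_m.+1, V s 0 <= W s 0.

Definition span_seminorm (R : realType) (m : nat) (W : 'cV[R]_m.+1) : R :=
  fmax ord0 (fun s : 'I_m.+1 => W s 0) - fmin ord0 (fun s : 'I_m.+1 => W s 0).

Definition stochastic (R : realType) (m : nat) (A : 'M[R]_m.+1) : Prop :=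
  (forall i j, 0 <= A i j) /\ (forall i, \sum_j A i j = 1).

Definition Cesaro_mean (R : realType) (m : nat) (A : 'M[R]_m.+1) (n : nat) :
    'M[R]_m.+1 :=
  n%:R^-1 *: \sum_(0 <= k < n) A ^+ k.

(* The limit exists for every stochastic matrix; it is taken in the normed
   topology of matrices, i.e. entrywise. *)
Definition Cesaro_limit (R : realType) (m : nat) (A : 'M[R]_m.+1) :
    'M[R]_m.+1 :=
  lim (Cesaro_mean A @ \oo).

Section Model.
Variables (R : realType) (m : nat) (D : finType).
Variables (Rw : D -> 'cV[R]_m.+1) (Q : D -> 'M[R]_m.+1).

Definition simultaneous_max : Prop :=
  forall (beta : R) (W : 'cV[R]_m.+1), 0 <= beta <= 1 ->
    exists dh : D, forall d : D,
      lev (Rw d + beta *: (Q d *m W)) (Rw dh + beta *: (Q dh *m W)).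

Definition average_optimal (ds : D) : Prop :=
  forall d : D,
    lev (Cesaro_limit (Q d) *m Rw d) (Cesaro_limit (Q ds) *m Rw ds).

Variable d0 : D.

Definition Uop (W : 'cV[R]_m.+1) : 'cV[R]_m.+1 :=
  \col_s fmax d0 (fun d : D => (Rw d + Q d *m W) s 0).

Definition value_iter (W : 'cV[R]_m.+1) (k : nat) : 'cV[R]_m.+1 :=
  iter k Uop W.

(* With horizon T and terminal reward W, the maximal expected reward over the
   T - t steps following step t is value_iter W (T - t), so a decision is
   optimal on step t, 1 <= t <= T, when it attains the component-wise maximum
   of Rw d + Q d *m value_iter W (T - t). *)
Definition step_optimal (W : 'cV[R]_m.+1) (T t : nat) (dh : D) : Prop :=
  Rw dh + Q dh *m value_iter W (T - t) = Uop (value_iter W (T - t)).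

End Model.

(* Main.v *)
(* For a stochastic A put B = 1 - A. As the powers of A are bounded, im B and
   ker B meet only in 0, so B = X B B for some X; the Cesaro means of A then
   equal 1 - X B up to a term n^-1 X (1 - A^n), so they converge to a stochastic
   P with P A = P.
   If dh attains the maximum at W^k, applying P(dh) to
   Rw dh = (W^{k+1} - W^k) + (1 - Q dh) W^k shows that the gain of dh is at least
   min (W^{k+1} - W^k); in the same way every gain is at most
   max (W^{k+1} - W^k). Hence no gain exceeds that of dh by more than the span,
   and finitely many decisions have only finitely many gain differences. *)
Require Import Defs.
From HB Require Import structures.
From mathcomp Require Import all_boot all_order all_algebra.
From mathcomp Require Import all_classical all_reals all_analysis.
From mathcomp Require Import zify lra.
Import Order.TTheory GRing.Theory Num.Theory.
Import numFieldNormedType.Exports.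

Set Implicit Arguments.
Unset Strict Implicit.

Local Open Scope classical_set_scope.
Local Open Scope ring_scope.

Lemma cvg_mx (R : realType) (m n : nat) (f : nat -> 'M[R]_(m.+1, n.+1))
    (L : 'M[R]_(m.+1, n.+1)) :
  (forall i j, (fun k => f k i j) @ \oo --> L i j) -> f @ \oo --> L.
Proof.
(* A neighbourhood of [L] contains a product of entrywise neighbourhoods [E i j]; as there are
   finitely many entries, their eventual conditions can be intersected. *)
move=> fL P [E EL EP]; apply: (filterS
  (P := fun k => forall i j, E i j (f k i j))).
  by move=> k Ek; apply: EP.
have Enear i j : \forall k \near \oo, E i j (f k i j) by exact: fL (EL i j).
by have := filter_forall _ (fun i => filter_forall _ (Enear i)); apply;
  exact: eventually_filter.
Qed.

Lemma stochastic_exp (R : realType) (m : nat) (A : 'M[R]_m.+1) (n : nat) :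
  stochastic A -> stochastic (A ^+ n).
Proof.
move=> [A0 A1]; elim: n => [|n [P0 P1]].
  rewrite expr0; split=> [i j|i]; first by rewrite mxE ler0n.
  rewrite (bigD1 i) //= big1 ?mxE ?eqxx ?addr0 // => j ji.
  by rewrite mxE eq_sym (negbTE ji).
rewrite exprS; split=> [i j|i].
  by rewrite mxE sumr_ge0 // => k _; rewrite mulr_ge0.
under eq_bigr do rewrite mxE.
rewrite exchange_big /= -[RHS](A1 i); apply: eq_bigr => k _.
by rewrite -mulr_sumr P1 mulr1.
Qed.

Lemma stochastic_entry_le1 (R : realType) (m : nat) (A : 'M[R]_m.+1) i j :
  stochastic A -> A i j <= 1.
Proof.
move=> [A0 A1]; rewrite -(A1 i) (bigD1 j) //= lerDl.
by apply: sumr_ge0 => k _.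
Qed.

(** The entries of [A ^+ n] lie in [0, 1], so those of [1 - A ^+ n] lie in [-1, 1] and the products
    with row [i] of [u] are bounded by [c] uniformly in [n]. A row [u] serves for the trivial
    intersection of image and kernel, a square one for the error term of the Cesaro means. *)
Lemma mean_defect_cvg0 (R : realType) (m p : nat) (A : 'M[R]_m.+1)
    (u : 'M[R]_(p, m.+1)) i j : stochastic A ->
  (fun n : nat => n%:R^-1 * (u *m (1 - A ^+ n)) i j) @ \oo --> (0 : R).
Proof.
move=> As; pose c := \sum_k `|u i k|.
have n1 : (fun n : nat => n%:R^-1 : R) @ \oo --> (0 : R).
  by rewrite -cvg_shiftS; exact: cvg_harmonic.
apply/norm_cvg0P.
apply: (@squeeze_cvgr _ _ _ _ (fun=> 0) (fun n : nat => n%:R^-1 * c)).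
- near=> n; rewrite normr_ge0 /= normrM ger0_norm ?invr_ge0 //.
  rewrite ler_wpM2l ?invr_ge0 // mxE (le_trans (ler_norm_sum _ _ _)) //.
  apply: ler_sum => k _; rewrite normrM ler_piMr //.
  have /(stochastic_entry_le1 k j) := stochastic_exp n As.
  have [/(_ k j) + _] := stochastic_exp n As.
  rewrite 3!mxE ler_norml => h0 h1.
  by case: (k == j) => /=; apply/andP; split; lra.
- exact: cvg_cst.
- by rewrite -[X in _ --> X](mul0r c); apply: cvgM => //; exact: cvg_cst.
Unshelve. all: by end_near. Qed.

Lemma one_sub_mul_sum (R : realType) (m : nat) (A : 'M[R]_m.+1) (n : nat) :
  (1 - A) *m (\sum_(0 <= k < n) A ^+ k) = 1 - A ^+ n.
Proof.
by rewrite big_mkord -[RHS]opprB subrX1 -mulNr opprB.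
Qed.

(* A fixed row u B of A satisfies n (u B) = u (1 - A^n), which is bounded. *)
Lemma im_ker_one_sub_stochastic (R : realType) (m : nat) (A : 'M[R]_m.+1) :
  stochastic A -> ((1 - A) :&: kermx (1 - A))%MS = 0.
Proof.
move=> As; apply/eqP/rowV0P => v; rewrite sub_capmx => /andP[/submxP[u vu]].
move=> /sub_kermxP; rewrite mulmxBr mulmx1 => /subr0_eq vA.
have vAn n : v *m A ^+ n = v.
  by elim: n => [|n IH]; rewrite ?expr0 ?mulmx1 // exprS mulmxA -vA.
apply/rowP => j; rewrite [RHS]mxE; have := mean_defect_cvg0 u 0 j As.
apply: (@cvg_unique R (@norm_hausdorff _ _) (_ @ \oo)).
apply: (cvg_near_cst (v 0 j)); near=> n.
have n0 : (n%:R : R) != 0 by rewrite pnatr_eq0 -lt0n; near: n; exists 1%N.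
rewrite -one_sub_mul_sum mulmxA -vu mulmx_sumr (eq_bigr (fun=> v)) //.
rewrite sumr_const_nat subn0.
by rewrite mulmxnE -[v 0 j *+ n]mulr_natl mulrA mulVf ?mul1r.
Unshelve. all: by end_near. Qed.

Lemma Cesaro_limit_fixed_stochastic (R : realType) (m : nat) (A : 'M[R]_m.+1) :
  stochastic A ->
  Cesaro_limit A *m A = Cesaro_limit A /\ stochastic (Cesaro_limit A).
Proof.
move=> As; pose B := 1 - A.
(* By rank-nullity, [B *m B] loses the rank of the intersection of im B and ker B, which is zero;
   equal ranks turn the inclusion of row spaces around. *)
have /submxP[X BX] : (B <= B *m B)%MS.
  rewrite -(mxrank_leqif_sup (submxMl B B)).
  by rewrite -[X in _ == X](mxrank_mul_ker B B)
    im_ker_one_sub_stochastic // mxrank0 addn0.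
pose P := 1 - X *m B.
have PB : P *m B = 0 by rewrite mulmxBl mul1mx -mulmxA -BX subrr.
have PA : P *m A = P.
  by move: PB; rewrite mulmxBr mulmx1 => /subr0_eq.
have PAn n : P *m A ^+ n = P.
  by elim: n => [|n IH]; rewrite ?expr0 ?mulmx1 // exprS mulmxA PA.
(* Since X B = 1 - P, the telescoped X (1 - A^n) is (1 - P) applied to the sum of powers, that is,
   the sum minus n P. At n = 0 the mean is 0, whence the restriction. *)
have meanE n : (0 < n)%N ->
    Cesaro_mean A n = P + n%:R^-1 *: (X *m (1 - A ^+ n)).
  move=> n0; rewrite -one_sub_mul_sum mulmxA -/B.
  rewrite -[X *m B](subKr 1) -/P mulmxBl mul1mx mulmx_sumr.
  under [in X in _ - X]eq_bigr do rewrite PAn.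
  rewrite sumr_const_nat subn0 scalerBr -[P *+ n]scaler_nat scalerA mulVf
    ?pnatr_eq0 -?lt0n //.
  by rewrite scale1r addrC subrK.
have meanP i j : (fun n => Cesaro_mean A n i j) @ \oo --> P i j.
  rewrite -[P i j]addr0.
  apply: (cvg_trans (G := (fun n : nat =>
      P i j + n%:R^-1 * (X *m (1 - A ^+ n)) i j) @ \oo)).
    apply: near_eq_cvg; near=> n.
    by rewrite meanE ?mxE //; near: n; exists 1%N.
  by apply: cvgD; [exact: cvg_cst | exact: mean_defect_cvg0].
have -> : Cesaro_limit A = P.
  by apply: cvg_lim; [exact: norm_hausdorff | exact: cvg_mx].
split=> //; split=> [i j|i].
  apply: (@ler_cvg_to _ _ _ _ (fun=> 0) _ _ _ _ (meanP i j)); first exact: cvg_cst.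
  near=> n; rewrite /Cesaro_mean mxE mulr_ge0 ?invr_ge0 // summxE.
  apply: sumr_ge0 => k _.
  by have [+ _] := stochastic_exp k As; apply.
(* The row sums of P come from algebra rather than from the limit: B kills the constant vector, so P
   fixes it. *)
have B1 : B *m const_mx 1 = 0 :> 'cV_m.+1.
  apply/colP => s; rewrite mulmxBl mul1mx !mxE -[X in X - _](As.2 s).
  by apply/eqP; rewrite subr_eq0; apply/eqP/eq_bigr => k _; rewrite mxE mulr1.
have P1 : P *m const_mx 1 = const_mx 1 :> 'cV_m.+1.
  by rewrite mulmxBl mul1mx -mulmxA B1 mulmx0 subr0.
have := congr1 (fun v : 'cV_m.+1 => v i 0) P1; rewrite !mxE => <-.
by apply: eq_bigr => k _; rewrite [const_mx _ _ _]mxE mulr1.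
Unshelve. all: by end_near. Qed.

Lemma stochastic_mul_ge (R : realType) (m : nat) (P : 'M[R]_m.+1)
    (V : 'cV[R]_m.+1) (a : R) s :
  stochastic P -> (forall k, a <= V k 0) -> a <= (P *m V) s 0.
Proof.
move=> [P0 P1] aV; rewrite mxE -[a]mul1r -(P1 s) mulr_suml.
by apply: ler_sum => k _; rewrite ler_wpM2l.
Qed.

Lemma stochastic_mul_lev (R : realType) (m : nat) (P : 'M[R]_m.+1)
    (V V' : 'cV[R]_m.+1) :
  stochastic P -> lev V V' -> lev (P *m V) (P *m V').
Proof.
by move=> [P0 _] VV' s; rewrite !mxE; apply: ler_sum => k _; rewrite ler_wpM2l.
Qed.

Lemma lev_Uop (R : realType) (m : nat) (D : finType) (d0 d : D)
    (Rw : D -> 'cV[R]_m.+1) (Q : D -> 'M[R]_m.+1) (W : 'cV[R]_m.+1) :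
  lev (Rw d + Q d *m W) (Uop Rw Q d0 W).
Proof.
move=> s; rewrite [leRHS]mxE /fmax.
exact: (le_bigmax _ (fun d => (Rw d + Q d *m W) s 0)).
Qed.

(** The Cesaro limit absorbs [A], so it annihilates A W - W. This lets the reward be traded for a
    one-step increment of value iteration. *)
Lemma gainE (R : realType) (m : nat) (r W : 'cV[R]_m.+1) (A : 'M[R]_m.+1) :
  stochastic A ->
  Cesaro_limit A *m r = Cesaro_limit A *m (r + A *m W - W).
Proof.
move=> /Cesaro_limit_fixed_stochastic[PA _].
by rewrite mulmxBr mulmxDr mulmxA PA addrK.
Qed.

Lemma gain_diff_le_span (R : realType) (m : nat) (D : finType) (d0 d dh : D)
    (Rw : D -> 'cV[R]_m.+1) (Q : D -> 'M[R]_m.+1) (W : 'cV[R]_m.+1) s :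
  (forall d, stochastic (Q d)) ->
  Rw dh + Q dh *m W = Uop Rw Q d0 W ->
  (Cesaro_limit (Q d) *m Rw d) s 0 - (Cesaro_limit (Q dh) *m Rw dh) s 0
    <= span_seminorm (Uop Rw Q d0 W - W).
Proof.
move=> Qs dhopt; pose V := Uop Rw Q d0 W - W.
have [_ Ps] := Cesaro_limit_fixed_stochastic (Qs d).
have [_ Psh] := Cesaro_limit_fixed_stochastic (Qs dh).
rewrite (gainE (Rw d) W (Qs d)) (gainE (Rw dh) W (Qs dh)) dhopt.
(* For [dh] the increment is exactly [V], for [d] it is at most [V]; averaging with stochastic rows
   keeps the bounds by the minimum and the maximum of [V]. *)
apply: lerB; last first.
  apply: stochastic_mul_ge => // k; exact: (bigmin_le _ k (fun s => V s 0)).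
have VM : lev (Rw d + Q d *m W - W)
    (const_mx (fmax ord0 (fun s : 'I_m.+1 => V s 0))).
  move=> k; rewrite [leRHS]mxE; apply: le_trans (le_bigmax _ (fun s => V s 0) k).
  by rewrite mxE [leRHS]mxE lerD2r lev_Uop.
apply: le_trans (stochastic_mul_lev Ps VM s) _.
rewrite -[leRHS]mul1r mxE.
under eq_bigr do rewrite mxE.
by rewrite -mulr_suml Ps.2 mul1r.
Qed.

Unset Implicit Arguments.
Set Strict Implicit.

Theorem theorem1 (R : realType) (m : nat) (D : finType) (d0 : D)
    (Rw : D -> 'cV[R]_m.+1) (Q : D -> 'M[R]_m.+1)
    (Q_stochastic : forall d : D, stochastic (Q d))
    (model_max : simultaneous_max Rw Q)
    (W : 'cV[R]_m.+1)
    (span_cvg0 : (fun k : nat => span_seminorm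
        (value_iter Rw Q d0 W k.+1 - value_iter Rw Q d0 W k)) @ \oo --> (0 : R)) :
  exists K : nat, forall T : nat, (K < T)%N ->
    forall t : nat, (1 <= t <= T - K)%N ->
      forall dh : D, step_optimal Rw Q d0 W T t dh -> average_optimal Rw Q dh.
Proof.
pose g d s := (Cesaro_limit (Q d) *m Rw d) s 0.
(* The least positive gain difference over pairs of decisions and states, capped at 1; the cap also
   keeps it positive when no difference is positive. *)
pose gap := \big[Num.min/1]_(x : D * D * 'I_m.+1 | 0 < g x.1.1 x.2 - g x.1.2 x.2)
  (g x.1.1 x.2 - g x.1.2 x.2).
have gap_gt0 : 0 < gap by apply/bigmin_gtP; split=> [|i]; first exact: ltr01.
have [K _ Kgap] := cvgr_lt 0 span_cvg0 gap gap_gt0.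
exists K => T KT t /andP[t1 tTK] dh dhopt d s.
rewrite leNgt -subr_gt0; apply/negP => gpos.
have Kn : (K <= T - t)%N by lia.
(* A positive difference would be at least [gap], whereas the span at index [T - t] is already below
   [gap]. *)
have := gain_diff_le_span d s Q_stochastic dhopt.
apply/negP; rewrite -ltNge; apply: (lt_le_trans (Kgap _ Kn)).
exact: (@bigmin_le_cond _ _ _ _ (d, dh, s)
  (fun x : D * D * 'I_m.+1 => 0 < g x.1.1 x.2 - g x.1.2 x.2)
  (fun x => g x.1.1 x.2 - g x.1.2 x.2)).
Qed.
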